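(* For an absolutely continuous real random variable $X$ with max-score function $\Theta_X$, the entropy $H(X)$ satisfies $$H(X) = 1 - \mathbb{E}\,\Theta_X(X).$$
   Context: For an absolutely continuous real random variable $X$ with distribution function $F_X(x)=\mathbb{P}(X\le x)$ and density $f_X = F_X'$, the max-score function is $\Theta_X(x) := \log\left(f_X(x)/F_X(x)\right)$. The (differential) entropy is $H(X) = -\int_{-\infty}^{\infty} f_X(x)\log f_X(x)\,dx$. Logarithms are natural. *)

(* Defs.v *)
From HB Require Import structures.
From mathcomp Require Import all_boot all_order all_algebra.
From mathcomp Require Import all_classical all_reals all_analysis.

Set Implicit Arguments.
Unset Strict Implicit.
Unset Printing Implicit Defensive.

Import Order.TTheory GRing.Theory Num.Theory.
Import numFieldNormedType.Exports.

Local Open Scope classical_set_scope.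
Local Open Scope ring_scope.

Definition absolutely_continuous_rv (d : measure_display)
    (T : measurableType d) (R : realType) (P : probability T R)
    (X : {RV P >-> R}) : Prop :=
  distribution P X `<< (@lebesgue_measure R).

(* The cdf of the library takes values in \bar R; it is finite everywhere. *)
Definition distr_fun (d : measure_display) (T : measurableType d)
    (R : realType) (P : probability T R) (X : {RV P >-> R}) (x : R) : R :=
  fine (cdf X x).

(* The derivative of an absolutely continuous F exists only almost everywhere.
   Elsewhere [derive1] takes an irrelevant default value; this concerns a set
   which is null for the Lebesgue measure and for the law of X. *)
Definition density (d : measure_display) (T : measurableType d)
    (R : realType) (P : probability T R) (X : {RV P >-> R}) : R -> R :=
  (distr_fun X)^`()%classic.

(* [ln] is 0 on nonpositive reals and x / 0 = 0; for absolutely continuous X,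
   the points where the density or F vanishes form a null set for the law
   of X. *)
Definition max_score (d : measure_display) (T : measurableType d)
    (R : realType) (P : probability T R) (X : {RV P >-> R}) (x : R) : R :=
  ln (density X x / distr_fun X x).

(* Where the density vanishes the integrand is 0 (the convention
   0 log 0 = 0).  The integral is extended-real valued. *)
Definition entropy (d : measure_display) (T : measurableType d)
    (R : realType) (P : probability T R) (X : {RV P >-> R}) : \bar R :=
  (- \int[@lebesgue_measure R]_x (density X x * ln (density X x))%:E)%E.

(* Main.v *)
Require Import Defs.
From HB Require Import structures.
From mathcomp Require Import all_boot all_order all_algebra.
From mathcomp Require Import all_classical all_reals all_analysis.
From mathcomp Require Import measurable_realfun lra.

Set Implicit Arguments.
Unset Strict Implicit.
Unset Printing Implicit Defensive.

Import Order.TTheory GRing.Theory Num.Theory.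
Import numFieldNormedType.Exports.

Local Open Scope classical_set_scope.
Local Open Scope ring_scope.
(** Write F for the distribution function and f for the density of X.  Almost
surely f(X) > 0 and F(X) > 0, so the max-score of X at X is
ln f(X) - ln F(X).  By absolute continuity F is continuous, hence F(X) is
uniform on [0, 1] and - ln F(X) is a standard exponential variable, of
expectation 1 ([integral_Nln_distr_fun]).  Therefore

  E max_score(X) = E ln f(X) + 1 = \int f ln f + 1 = 1 - H(X).

Three points need care.

- The function [density] is the pointwise derivative of F.  The
  Radon-Nikodym derivative r of the law of X is used in its place: Lebesgue's
  differentiation theorem gives F' = r almost everywhere ([density_eq_ae]).
  At the exceptional points [density] has no controlled value, and integrals
  are transported from it to r by [ae_eq_integral_null_set].

- The entropy may be infinite, or the integral of f ln f may be of the form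
  oo - oo.  The splitting of E (ln f(X) - ln F(X)) remains valid because the
  second term is integrable: adding an integrable function does not change
  which of the positive and negative parts have an infinite integral
  ([integralDr_integrable]).  The change of variables between f ln f and
  ln f(X) is made on positive and negative parts separately
  ([radon_nikodym_real], [integral_law]).

- Uniformity of F(X) comes from the intermediate value theorem: if
  F x = u then {F(X) < u} is contained in {X <= x}, which is contained in
  {F(X) <= u}, and the event in the middle has probability u. *)

(** * Integrals that are possibly infinite *)

Section integral_ae.
Context d (T : measurableType d) (R : realType).
Variable mu : {measure set T -> \bar R}.
Local Open Scope ereal_scope.
Import HBNNSimple.

(** A simple function below f, set to 0 on the null set, lies below g and keeps
its integral.  The integral being a supremum over simple functions for every
f, the comparison also covers functions that are not measurable on N. *)
Lemma ge0_le_integral_nullset (N : set T) (f g : T -> \bar R) :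
  measurable N -> mu N = 0 -> (forall x, 0 <= f x) -> (forall x, 0 <= g x) ->
  (forall x, ~ N x -> f x = g x) -> \int[mu]_x f x <= \int[mu]_x g x.
Proof.
move=> mN muN f0 g0 fg; rewrite !ge0_integralTE//.
apply: ge_ereal_sup => _ [h /= hf <-].
pose h' := proj_nnsfun h (measurableC mN).
apply: ereal_sup_ubound; exists h' => /=.
  move=> x; rewrite /= mindicE; have [xN|xN] := boolP (x \in ~` N).
    by rewrite mulr1 -fg//; move: xN; rewrite inE.
  by rewrite mulr0.
have E (k : {nnsfun T >-> R}) : sintegral mu k = \int[mu]_x (k x)%:E.
  by rewrite integral_nnsfun// patch_setT.
rewrite !E; apply: ge0_ae_eq_integral => //.
- exact/measurable_EFinP.
- exact/measurable_EFinP.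
- by move=> x _; rewrite lee_fin.
- by move=> x _; rewrite lee_fin.
- exists N; split=> // x /= /not_implyP[_]; apply: contra_notP => Nx.
  by rewrite /= mindicE mem_set// mulr1.
Qed.

Lemma ae_eq_integral_null_set (f g : T -> \bar R) :
  ae_eq mu setT f g -> \int[mu]_x f x = \int[mu]_x g x.
Proof.
move=> [N [mN muN fgN]].
have fg x : ~ N x -> f x = g x.
  by move=> Nx; apply: contrapT => fgx; apply/Nx/fgN => /(_ I).
rewrite integralE [RHS]integralE; congr (_ - _); apply/eqP; rewrite eq_le;
  apply/andP; split; apply: (ge0_le_integral_nullset mN muN) => // x Nx;
  by rewrite ?funeposE ?funenegE fg.
Qed.

(** The positive (resp. negative) parts of g and g + h differ by at most |h|, so
their integrals are finite or infinite together.  If all are finite this is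
additivity for integrable functions; otherwise both sides are the same
infinity, where oo - oo counts as -oo on both sides. *)
Lemma integralDr_integrable (g h : T -> R) :
  measurable_fun setT g -> mu.-integrable setT (EFin \o h) ->
  \int[mu]_x (g x + h x)%:E = \int[mu]_x (g x)%:E + \int[mu]_x (h x)%:E.
Proof.
move=> mg ih.
have mh : measurable_fun setT h by apply/measurable_EFinP; case/integrableP: ih.
have mgh : measurable_fun setT (g \+ h)%R by exact: measurable_funD.
have H : \int[mu]_x `|(h x)%:E| < +oo by case/integrableP: ih.
have Hi : \int[mu]_x (h x)%:E \is a fin_num by exact: integrable_fin_num.
have bnd (a b : T -> R) : measurable_fun setT a -> measurable_fun setT b ->
    (forall x, `|a x - b x| <= `|h x|)%R ->
  \int[mu]_x (EFin \o b)^\+ x < +oo -> \int[mu]_x (EFin \o a)^\+ x < +oo.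
  move=> ma mb abh bfin.
  apply: (@le_lt_trans _ _ (\int[mu]_x ((EFin \o b)^\+ x + `|(h x)%:E|))).
    apply: ge0_le_integral => //.
    - exact/measurable_funepos/measurable_EFinP.
    - apply: emeasurable_funD; first exact/measurable_funepos/measurable_EFinP.
      by apply: measurableT_comp => //; exact/measurable_EFinP.
    - move=> x _; rewrite !funeposE /= -!EFin_max -EFinD lee_fin.
      have := abh x; rewrite ler_norml => /andP[_ ?].
      have b0 : (b x <= Num.max (b x) 0)%R by rewrite le_max lexx.
      have b1 : (0 <= Num.max (b x) 0)%R by rewrite le_max lexx orbT.
      have := normr_ge0 (h x); rewrite ge_max => ?; apply/andP; split; lra.
  rewrite ge0_integralD//.
  - by rewrite lte_add_pinfty.
  - exact/measurable_funepos/measurable_EFinP.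
  - by apply: measurableT_comp => //; exact/measurable_EFinP.
have negE (a : T -> R) : \int[mu]_x (EFin \o a)^\- x =
    \int[mu]_x (EFin \o (fun x => - a x)%R)^\+ x.
  by apply: eq_integral => x _; rewrite funenegE funeposE /= EFinN.
have bndD (a b : T -> R) : measurable_fun setT a -> measurable_fun setT b ->
    (forall x, `|a x - b x| <= `|h x|)%R ->
  (\int[mu]_x (EFin \o a)^\+ x < +oo) = (\int[mu]_x (EFin \o b)^\+ x < +oo).
  move=> ma mb ab; apply/idP/idP; apply: bnd => // x.
  by rewrite distrC.
have mN (a : T -> R) :
    measurable_fun setT a -> measurable_fun setT (fun x => - a x)%R.
  by move=> ma; exact: measurableT_comp.
have Pp : (\int[mu]_x (EFin \o g)^\+ x < +oo) =
    (\int[mu]_x (EFin \o (g \+ h)%R)^\+ x < +oo).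
  by apply: bndD => // x /=; rewrite opprD addNKr normrN.
have Pm : (\int[mu]_x (EFin \o g)^\- x < +oo) =
    (\int[mu]_x (EFin \o (g \+ h)%R)^\- x < +oo).
  rewrite !negE; apply: bndD => //; [exact: mN|exact: mN|move=> x /=].
  by rewrite opprK addrC addrAC subrr add0r.
have [gf|] := boolP ((\int[mu]_x (EFin \o g)^\+ x < +oo) &&
                      (\int[mu]_x (EFin \o g)^\- x < +oo)).
  case/andP: gf => gp gm.
  rewrite -integralD_EFin//; apply/integrableP; split.
    exact/measurable_EFinP.
  under eq_integral do rewrite -/((abse \o (EFin \o g)) _) fune_abse.
  rewrite ge0_integralD//; first by rewrite lte_add_pinfty.
    exact/measurable_funepos/measurable_EFinP.
  exact/measurable_funeneg/measurable_EFinP.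
rewrite negb_and => gf.
have p0 (a : T -> R) : 0 <= \int[mu]_x (EFin \o a)^\+ x by exact: integral_ge0.
have m0 (a : T -> R) : 0 <= \int[mu]_x (EFin \o a)^\- x by exact: integral_ge0.
rewrite integralE [X in _ = X + _]integralE.
move: (p0 g) (p0 (g \+ h)%R) (m0 g) (m0 (g \+ h)%R) Pp Pm gf Hi.
rewrite -!/(_ \o _).
case: (integral mu setT ((EFin \o g)^\+)) => [a||] //;
case: (integral mu setT ((EFin \o g)^\-)) => [b||] //;
case: (integral mu setT ((EFin \o (g \+ h)%R)^\+)) => [a'||] //;
case: (integral mu setT ((EFin \o (g \+ h)%R)^\-)) => [b'||] //;
case: (\int[mu]_x (h x)%:E) => [e||] //=; rewrite ?ltry ?ltxx //.
Qed.
End integral_ae.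

(** * The law of an absolutely continuous random variable *)

(** The last clause holds for every measurable h, whether or not its integral
exists: r being nonnegative, it commutes with taking positive and negative
parts, which reduces the claim to nonnegative functions. *)
Lemma radon_nikodym_real d (T : measurableType d) (R : realType)
    (mu : {sigma_finite_measure set T -> \bar R})
    (nu : {finite_measure set T -> \bar R}) : nu `<< mu ->
  exists r : T -> R, [/\ forall x, (0 <= r x)%R,
    mu.-integrable setT (EFin \o r),
    (forall A, measurable A -> nu A = (\int[mu]_(x in A) (r x)%:E)%E) &
    (forall h : T -> R, measurable_fun setT h ->
      (\int[mu]_x (r x * h x)%:E = \int[nu]_x (h x)%:E)%E)].
Proof.
move=> numu.
pose g := Radon_Nikodym_SigmaFinite.f nu mu.
have g0 x : (0 <= g x)%E by exact: Radon_Nikodym_SigmaFinite.f_ge0.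
have gfin x : g x \is a fin_num by exact: Radon_Nikodym_SigmaFinite.f_fin_num.
have gE : EFin \o (fine \o g) = g by apply/funext => x /=; rewrite fineK.
have ig : mu.-integrable setT g by exact: Radon_Nikodym_SigmaFinite.f_integrable.
exists (fine \o g); split.
- by move=> x; exact: fine_ge0.
- by rewrite gE.
- move=> A mA; rewrite (_ : nu A = (\int[mu]_(x in A) g x)%E).
    by apply: eq_integral => x _; rewrite /= fineK.
  exact: Radon_Nikodym_SigmaFinite.f_integral.
- move=> h mh.
  have mEh : measurable_fun setT (EFin \o h) by exact/measurable_EFinP.
  rewrite integralE [RHS]integralE; congr (_ - _)%E.
    rewrite -(Radon_Nikodym_SigmaFinite.change_of_variables numu)//; last first.
      exact: measurable_funepos.
    apply: eq_integral => x _; rewrite -/(g x) -[in RHS](fineK (gfin x)).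
    rewrite !funeposE -!EFin_max -EFinM.
    by rewrite [in RHS]mulrC maxr_pMr ?fine_ge0// mulr0.
  rewrite -(Radon_Nikodym_SigmaFinite.change_of_variables numu)//; last first.
    exact: measurable_funeneg.
  apply: eq_integral => x _; rewrite -/(g x) -[in RHS](fineK (gfin x)).
  rewrite !funenegE -!EFinN -!EFin_max -EFinM.
  by rewrite [in RHS]mulrC maxr_pMr ?fine_ge0// mulr0 mulrN.
Qed.

Lemma integral_law d d' (T : measurableType d) (T' : measurableType d')
    (R : realType) (P : probability T R) (X : {mfun T >-> T'}) (h : T' -> R) :
  measurable_fun setT h ->
  (\int[distribution P X]_x (h x)%:E = \int[P]_w (h (X w))%:E)%E.
Proof.
move=> mh; have mEh : measurable_fun setT (EFin \o h) by exact/measurable_EFinP.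
rewrite integralE [RHS]integralE; congr (_ - _)%E.
  rewrite ge0_integral_distribution//; last exact: measurable_funepos.
  by apply: eq_integral => w _; rewrite /= !funeposE.
rewrite ge0_integral_distribution//; last exact: measurable_funeneg.
by apply: eq_integral => w _; rewrite /= !funenegE.
Qed.

Section law.
Context d (T : measurableType d) (R : realType) (P : probability T R).
Variable X : {RV P >-> R}.
Local Open Scope ereal_scope.
Let mu : {sigma_finite_measure set (measurableTypeR R) -> \bar R} :=
  @lebesgue_measure R.
Let nu := distribution P X.

Lemma radon_nikodym_law : absolutely_continuous_rv X ->
  exists r : R -> R, [/\ forall x, (0 <= r x)%R,
    mu.-integrable setT (EFin \o r),
    (forall A, measurable A -> nu A = \int[mu]_(x in A) (r x)%:E) &
    (forall h : R -> R, measurable_fun setT h ->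
      \int[mu]_x (r x * h x)%:E = \int[P]_w (h (X w))%:E)].
Proof.
have mX : @measurable_fun _ _ T (measurableTypeR R) setT X := measurable_funPT X.
(* The real line occurs with two distinct measurable structures, equal up to
   their display: that of the codomain of X and that of the domain of the
   Lebesgue measure.  X' is X with values in the second. *)
pose X' : {mfun T >-> measurableTypeR R} :=
  HB.pack (X : T -> measurableTypeR R) (isMeasurableFun.Build _ _ _ _ _ mX).
pose nu' : {finite_measure set (measurableTypeR R) -> \bar R} :=
  distribution P X'.
move=> acX.
have [r [r0 ir nuE chv]] :=
  @radon_nikodym_real _ (measurableTypeR R) R (@lebesgue_measure R) nu' acX.
exists r; split.
- exact: r0.
- exact: ir.
- exact: nuE.
- by move=> h mh; rewrite chv//; exact: (integral_law P X').
Qed.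

Lemma distr_fun_fineK x : (distr_fun X x)%:E = cdf X x.
Proof. by rewrite /distr_fun fineK// fin_num_measure. Qed.

Lemma density_eq_ae (r : R -> R) : mu.-integrable setT (EFin \o r) ->
  (forall A, measurable A -> nu A = \int[mu]_(x in A) (r x)%:E) ->
  {ae mu, forall x, density X x = r x}.
Proof.
move=> ir nuE.
have F : distr_fun X = (fun x => \int[mu]_(t in [set` `]-oo, x]]) (r t))%R.
  by apply/funext => x; rewrite /distr_fun /cdf -/nu nuE.
rewrite /density F.
have ir' y : mu.-integrable `]-oo, y] (EFin \o r) by exact: integrableS ir.
have lr := open_integrable_locally openT ir.
have [N [mN muN rN]] := FTC1Ny ir' lr.
exists N; split => //; apply: subset_trans rN => x /=.
by apply: contra_not => -[].
Qed.

(** An increment of F is the integral of r over an interval, which is small with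
the length of the interval by absolute continuity of the integral. *)
Lemma distr_fun_continuous (r : R -> R) : (forall x, (0 <= r x)%R) ->
  mu.-integrable setT (EFin \o r) ->
  (forall A, measurable A -> nu A = \int[mu]_(x in A) (r x)%:E) ->
  continuous (distr_fun X).
Proof.
move=> r0 ir nuE x; apply/cvgrPdist_lt => e e0.
have [dl [dl0 H]] := integral_normr_continuous ir e0.
have K (a b : R) : (a <= b)%R -> (b - a < dl)%R ->
    (`|distr_fun X b - distr_fun X a| < e)%R.
  move=> ab bad.
  have D : distribution P X `]-oo, b] =
      distribution P X `]-oo, a] + distribution P X `]a, b].
    rewrite -measureU//.
      by rewrite -itv_bndbnd_setU// bnd_simp.
    apply/seteqP; split=> // y /=; rewrite !in_itv/= => -[ya /andP[]].
    by rewrite ltNge ya.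
  have -> : (distr_fun X b - distr_fun X a = fine (nu `]a, b]))%R.
    by rewrite /distr_fun /cdf D fineD ?fin_num_measure// addrAC subrr add0r.
  rewrite ger0_norm ?fine_ge0// nuE//.
  have muab : mu `]a, b]%classic < dl%:E.
    rewrite /mu/= lebesgue_measure_itv/=; case: ifPn => _; last by rewrite lte_fin.
    by rewrite -EFinB lte_fin.
  have := H `]a, b]%classic (measurable_itv _) muab.
  by rewrite /Rintegral; under eq_integral do rewrite ger0_norm//.
near=> y.
have : (`|x - y| < dl)%R by near: y; exact: cvgr_dist_lt.
have [xy|/ltW yx] := leP x y.
  by rewrite distrC (distrC _ (distr_fun X y)) ger0_norm ?subr_ge0//; exact: K.
by rewrite ger0_norm ?subr_ge0//; exact: K.
Unshelve. all: by end_near. Qed.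

Lemma ae_law (Q : R -> Prop) : absolutely_continuous_rv X ->
  {ae mu, forall x, Q x} -> {ae P, forall w, Q (X w)}.
Proof.
move=> /null_content_dominatesP acX [N [mN muN QN]].
exists (X @^-1` N); split.
- exact: measurable_funPTI.
- exact: acX.
- by move=> w /= Qw; exact: QN.
Qed.

(** The law of X gives mass 0 to the zeros of its own density. *)
Lemma ae_law_gt0 (r : R -> R) : (forall x, (0 <= r x)%R) ->
  measurable_fun setT r ->
  (forall A, measurable A -> distribution P X A = \int[mu]_(x in A) (r x)%:E) ->
  {ae P, forall w, (0 < r (X w))%R}.
Proof.
move=> r0 mr nuE.
have mZ : measurable [set x | r x = 0%R].
  by rewrite -[X in measurable X]setTI; exact: (mr measurableT [set 0%R]).
exists (X @^-1` [set x | r x = 0%R]); split.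
- exact: measurable_funPTI.
- transitivity (distribution P X [set x | r x = 0%R]) => //.
  by rewrite nuE// integral0_eq// => x /= ->.
- move=> w /= /negP; rewrite -leNgt => rw.
  by apply/eqP; rewrite eq_le rw r0.
Qed.

End law.

(** * The probability integral transform *)

Section probability_integral_transform.
Context d (T : measurableType d) (R : realType) (P : probability T R).
Variable X : {RV P >-> R}.
Local Open Scope ereal_scope.
Let F := distr_fun X.
Hypothesis cF : continuous F.

Let FE x : (F x)%:E = cdf X x.
Proof. exact: distr_fun_fineK. Qed.

Let FP x : (F x)%:E = P (X @^-1` `]-oo, x]).
Proof. exact: FE. Qed.

Let F_nd : {homo F : x y / (x <= y)%R}.
Proof. by move=> x y xy; rewrite -lee_fin !FE; exact: cdf_nondecreasing. Qed.

Let F_le1 x : (F x <= 1)%R.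
Proof. by rewrite -lee_fin FE cdf_le1. Qed.

Lemma measurable_distr_fun : measurable_fun setT F.
Proof. exact: nondecreasing_measurable. Qed.

Let mFX : measurable_fun setT (F \o X).
Proof. by apply: measurableT_comp => //; exact: measurable_distr_fun. Qed.

Let mlt u : measurable [set w | (F (X w) < u)%R].
Proof.
rewrite (_ : [set _ | _] = (F \o X) @^-1` `]-oo, u[).
  by rewrite -[X in measurable X]setTI; exact: mFX.
by apply/seteqP; split => w /=; rewrite in_itv.
Qed.

Lemma measurable_distr_fun_le u : measurable [set w | (F (X w) <= u)%R].
Proof.
rewrite (_ : [set _ | _] = (F \o X) @^-1` `]-oo, u]).
  by rewrite -[X in measurable X]setTI; exact: mFX.
by apply/seteqP; split => w /=; rewrite in_itv.
Qed.

Let mle := measurable_distr_fun_le.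

Lemma distr_fun_surj (u : R) : (0 < u < 1)%R -> exists x, F x = u.
Proof.
move=> /andP[u0 u1].
have F0 : \forall x \near -oo%R, (F x < u)%R.
  by apply: cvgr_lt u0; exact: fine_cvg (cvg_cdfNy0 X).
have F1 : \forall x \near +oo%R, (u < F x)%R.
  by apply: cvgr_gt u1; exact: fine_cvg (cvg_cdfy1 X).
have [a Fa] := filter_ex F0.
have [b Fb] := filter_ex F1.
have ab : (a <= b)%R.
  by rewrite leNgt; apply/negP => /ltW /F_nd; rewrite leNgt (lt_trans Fa Fb).
have [||c _ Fc] := @IVT R F a b u ab.
- exact: continuous_subspaceT.
- by rewrite ge_min le_max (ltW Fa) (ltW Fb) orbT.
by exists c.
Qed.

Let le_prob_distr_fun (u : R) : (0 < u < 1)%R -> u%:E <= P [set w | (F (X w) <= u)%R].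
Proof.
move=> /distr_fun_surj[x <-]; rewrite FP; apply: le_measure; rewrite ?inE//.
  exact: measurable_funPTI.
by move=> w /=; rewrite in_itv/=; exact: F_nd.
Qed.

(** For u < 1, the upper bound compares {F(X) < u} with {X <= x} where F x = u.
The lower bound exhausts {F(X) < u} by the events {F(X) <= v} for v < u. *)
Lemma prob_distr_fun_lt (u : R) : (0 < u <= 1)%R ->
  P [set w | (F (X w) < u)%R] = u%:E.
Proof.
move=> /andP[u0 u1]; apply/eqP; rewrite eq_le; apply/andP; split.
  have [u_lt1|u_ge1] := ltP u 1%R; last first.
    by rewrite (le_trans (probability_le1 _ _)).
  have [|x Fx] := @distr_fun_surj u; first by rewrite u0 u_lt1.
  rewrite -{2}Fx FP; apply: le_measure; rewrite ?inE//.
    exact: measurable_funPTI.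
  move=> w /=; rewrite in_itv/= -Fx; apply: contraTT; rewrite -!ltNge -leNgt.
  by move=> /ltW; exact: F_nd.
apply/lee_addgt0Pr => e e0.
(* The term u / 2 only keeps v positive. *)
pose v := (Num.max (u - e) (u / 2))%R.
have v0 : (0 < v)%R by rewrite lt_max divr_gt0 ?orbT.
have vu : (v < u)%R by rewrite gt_max; apply/andP; split; lra.
have v01 : (0 < v < 1)%R by rewrite v0 (lt_le_trans vu u1).
have uv : (u <= v + e)%R by rewrite -lerBlDr le_max lexx.
apply: (@le_trans _ _ (v%:E + e%:E)); first by rewrite -EFinD lee_fin.
rewrite leeD2r// (le_trans (le_prob_distr_fun v01))//.
apply: le_measure; rewrite ?inE// => w /= /le_lt_trans; exact.
Qed.

Lemma prob_distr_fun_le0 : P [set w | (F (X w) <= 0)%R] = 0.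
Proof.
apply/eqP; rewrite eq_le measure_ge0 andbT; apply/lee_addgt0Pr => e e0.
pose v := Num.min e 1%R.
have v0 : (0 < v)%R by rewrite lt_min e0 ltr01.
rewrite add0e; apply: (@le_trans _ _ v%:E); last by rewrite lee_fin ge_min lexx.
rewrite -prob_distr_fun_lt ?v0 ?ge_min ?lexx ?orbT//.
by apply: le_measure; rewrite ?inE// => w /= /le_lt_trans; exact.
Qed.

(** This is the tail of the standard exponential distribution.  The points where
F(X) vanishes, at which [ln] is 0 by convention, form a null event. *)
Lemma prob_Nln_distr_fun_gt (r : R) : (0 <= r)%R ->
  P [set w | (r < - ln (F (X w)))%R] = (expR (- r))%:E.
Proof.
move=> r0.
rewrite -prob_distr_fun_lt ?expR_gt0 ?expR_le1 ?oppr_le0//.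
rewrite (_ : [set w | (r < - ln (F (X w)))%R] =
    [set w | (F (X w) < expR (- r))%R] `\` [set w | (F (X w) <= 0)%R]).
  rewrite measureD//; last by rewrite (le_lt_trans (probability_le1 _ _))// ltry.
  rewrite [X in _ - X](_ : _ = 0) ?sube0//.
  apply/eqP; rewrite eq_le measure_ge0 andbT -prob_distr_fun_le0.
  by apply: le_measure; rewrite ?inE//; exact: measurableI.
apply/seteqP; split => w /=.
  have [F0|F0] := leP (F (X w)) 0%R.
    by rewrite ln0// oppr0 ltNge r0.
  by rewrite ltrNr -[(ln _ < _)%R]ltr_expR lnK.
move=> [+ /negP]; rewrite -ltNge => FX F0.
by rewrite ltrNr -[(ln _ < _)%R]ltr_expR lnK ?posrE.
Qed.

Lemma measurable_Nln_distr_fun :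
  measurable_fun setT (fun w => - ln (F (X w)))%R.
Proof.
by apply: measurableT_comp => //; apply: measurableT_comp.
Qed.

(** Integrating the tail r |-> exp (- r) over the nonnegative reals gives the
total mass of the exponential distribution of rate 1. *)
Lemma integral_Nln_distr_fun : \int[P]_w (- ln (F (X w)))%:E = 1.
Proof.
pose Y : {RV P >-> R} := HB.pack (fun w => - ln (F (X w)))%R
  (isMeasurableFun.Build _ _ _ _ _ measurable_Nln_distr_fun).
have Y0 w : (0 <= Y w)%R by rewrite /Y/= oppr_ge0 ln_le0.
transitivity ('E_P[Y]); first by rewrite expectation_def.
rewrite ge0_expectation_ccdf//.
rewrite -(@integral_exponential_pdf R 1)//.
rewrite integral_mkcond; apply: eq_integral => r _.
rewrite /exponential_pdf !patchE; case: ifPn => //.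
rewrite inE/= in_itv/= andbT => r0; rewrite mul1r mulN1r -prob_Nln_distr_fun_gt//.
by congr (P _); apply/seteqP; split => w /=; rewrite in_itv/= andbT.
Qed.

End probability_integral_transform.

(** * Entropy and the max-score *)

Theorem proposition2p2 (d : measure_display) (T : measurableType d)
    (R : realType) (P : probability T R) (X : {RV P >-> R}) :
  absolutely_continuous_rv X ->
  entropy X = (1 - 'E_P[fun w => max_score X (X w)])%E.
Proof.
move=> acX; have [r [r0 ir nuE chv]] := radon_nikodym_law acX.
have mr : measurable_fun setT r by apply/measurable_EFinP; case/integrableP: ir.
have mlnr : measurable_fun setT (fun x => ln (r x)) by exact: measurableT_comp.
have fr := density_eq_ae ir nuE.
have cF := distr_fun_continuous r0 ir nuE.
have HE : (entropy X = - \int[P]_w (ln (r (X w)))%:E)%E.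
  rewrite /entropy -(chv (fun x => ln (r x)) mlnr); congr (- _)%E.
  apply: ae_eq_integral_null_set.
  case: fr => N [mN muN frN]; exists N; split => //.
  by apply: subset_trans frN => x /=; apply: contra_not => ->.
have iF : P.-integrable setT (EFin \o (fun w => - ln (distr_fun X (X w)))).
  apply/integrableP; split.
    exact/measurable_EFinP/measurable_Nln_distr_fun.
  under eq_integral => w _ /=.
    rewrite ger0_norm; last first.
      by rewrite oppr_ge0 ln_le0// -lee_fin distr_fun_fineK cdf_le1.
    over.
  by rewrite integral_Nln_distr_fun// ltry.
have F0 : {ae P, forall w, 0 < distr_fun X (X w)}.
  exists [set w | distr_fun X (X w) <= 0]; split.
  - exact: measurable_distr_fun_le.
  - exact: prob_distr_fun_le0.
  - by move=> w /= /negP; rewrite -leNgt.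
rewrite HE expectation.unlock.
rewrite (@ae_eq_integral_null_set _ _ _ _ (fun w => (max_score X (X w))%:E)
  (fun w => (ln (r (X w)) + - ln (distr_fun X (X w)))%:E)); last first.
  apply: filterS3 (ae_law acX fr) (ae_law_gt0 r0 mr nuE) F0.
  move=> w /= frw rw Fw _.
  by rewrite /max_score frw ln_div ?posrE.
rewrite integralDr_integrable//; last first.
  exact: measurableT_comp mlnr (measurable_funPT X).
rewrite integral_Nln_distr_fun//.
(* The identity - a = 1 - (a + 1) holds in the extended reals. *)
case: (\int[P]_w (ln (r (X w)))%:E)%E => [a||] //=.
by congr EFin; lra.
Qed.
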